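(* Let $I\subseteq(0,\infty)$ be an open interval, let $f:I\to\mathbb{R}$ be smooth, and let $M$ be the surface of revolution in $\mathbb{I}_p^3$ parameterized by $r(u,v)=(u\cosh v,\,u\sinh v,\,f(u))$, $u\in I$, $v\in\mathbb{R}$, with profile curve $u\mapsto(u,0,f(u))$. Suppose that $M$ has constant mean curvature $H_0$. Then there exist $c_1,c_2\in\mathbb{R}$ such that, for all $u\in I$, $$f(u)=\frac{H_0}{2}u^2+c_1\ln u+c_2.$$
   Context: The pseudo-isotropic space $\mathbb{I}_p^3$ is $\mathbb{R}^3$ with coordinates $(x,y,z)$ and the degenerate metric $ds^2=dx^2-dy^2$; for vectors $a=(a_1,a_2,a_3)$, $b=(b_1,b_2,b_3)$ that are not both parallel to the $z$-axis, $\langle a,b\rangle=a_1b_1-a_2b_2$. For a parameterized surface $r(u_1,u_2)$ without tangent planes parallel to the $z$-axis, put $g_{ij}=\langle r_{u_i},r_{u_j}\rangle$ and $h_{ij}=\det(r_{u_1},r_{u_2},r_{u_iu_j})/\sqrt{|\det(g_{ij})|}$, where subscripts $u_i$ denote partial derivatives and $\det$ of three vectors is the usual determinant in $\mathbb{R}^3$. The mean curvature is $H=\dfrac{g_{11}h_{22}-2g_{12}h_{12}+g_{22}h_{11}}{2\det(g_{ij})}$. For the surface in the claim, $(u_1,u_2)=(u,v)$. *)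

(* Defs.v *)
From Stdlib Require Export Reals.
From Coquelicot Require Export Coquelicot.
Open Scope R_scope.

Definition R3 : Type := (R * R * R)%type.

Definition coord1 (a : R3) : R := fst (fst a).
Definition coord2 (a : R3) : R := snd (fst a).
Definition coord3 (a : R3) : R := snd a.

(* The degenerate metric dx^2 - dy^2.  It is the inner product of the
   pseudo-isotropic space for vectors that are not both parallel to the z-axis;
   this covers all tangent vectors of a surface without tangent planes parallel
   to the z-axis, the only vectors it is applied to. *)
Definition pi_dot (a b : R3) : R := coord1 a * coord1 b - coord2 a * coord2 b.

Definition det3 (a b c : R3) : R :=
  coord1 a * (coord2 b * coord3 c - coord3 b * coord2 c)
  - coord2 a * (coord1 b * coord3 c - coord3 b * coord1 c)
  + coord3 a * (coord1 b * coord2 c - coord2 b * coord1 c).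

Definition surface : Type := R -> R -> R3.

Definition Derive3 (c : R -> R3) (t : R) : R3 :=
  (Derive (fun s => coord1 (c s)) t,
   Derive (fun s => coord2 (c s)) t,
   Derive (fun s => coord3 (c s)) t).

Definition pd1 (r : surface) : surface := fun u v => Derive3 (fun s => r s v) u.
Definition pd2 (r : surface) : surface := fun u v => Derive3 (fun s => r u s) v.

(* In [gcoef] and [hcoef] the indices i, j of g_ij and h_ij are given by the
   operators [pd1] and [pd2]. *)
Definition gcoef (Di Dj : surface -> surface) (r : surface) (u v : R) : R :=
  pi_dot (Di r u v) (Dj r u v).

Definition gdet (r : surface) (u v : R) : R :=
  gcoef pd1 pd1 r u v * gcoef pd2 pd2 r u v
  - gcoef pd1 pd2 r u v * gcoef pd2 pd1 r u v.

Definition hcoef (Di Dj : surface -> surface) (r : surface) (u v : R) : R :=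
  det3 (pd1 r u v) (pd2 r u v) (Dj (Di r) u v) / sqrt (Rabs (gdet r u v)).

Definition mean_curvature (r : surface) (u v : R) : R :=
  (gcoef pd1 pd1 r u v * hcoef pd2 pd2 r u v
   - 2 * gcoef pd1 pd2 r u v * hcoef pd1 pd2 r u v
   + gcoef pd2 pd2 r u v * hcoef pd1 pd1 r u v)
  / (2 * gdet r u v).

Definition revolution_surface (f : R -> R) : surface :=
  fun u v => (u * cosh v, u * sinh v, f u).

Definition open_interval (a b : Rbar) (x : R) : Prop :=
  Rbar_lt a x /\ Rbar_lt x b.

Definition smooth_on (I : R -> Prop) (f : R -> R) : Prop :=
  forall (n : nat) (x : R), I x -> ex_derive_n f n x.

(* Main.v *)
Require Import Defs.
From Stdlib Require Import Lra Classical FunctionalExtensionality.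

(** On this surface [g = diag(1, -u^2)], so the mean curvature is
    [(f' + u f'') / (2 u) = (u f')' / (2 u)] and the hypothesis reads
    [(u f' - H0 u^2)' = 0]. Integrating twice over the interval gives [f]. *)

(** The segment between two points of an interval stays inside it, so [eq_is_derive] applies on each
    such segment. This is the integration step, used twice in the theorem. *)
Lemma is_derive_zero_constant (a b : Rbar) (g : R -> R) :
  (forall u, open_interval a b u -> is_derive g u 0) ->
  exists c, forall u, open_interval a b u -> g u = c.
Proof.
intros Hg.
assert (Hlt : forall x y, x < y -> open_interval a b x -> open_interval a b y ->
  g x = g y).
{ intros x y Hxy [Hax _] [_ Hyb].
  apply (eq_is_derive g x y); [ | exact Hxy].
  intros t [Hxt Hty]; apply Hg; split.
  - now apply Rbar_lt_le_trans with x.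
  - now apply Rbar_le_lt_trans with y. }
(* The constant is the value at a base point; the bounds allow an empty interval, where any constant
   will do. *)
destruct (classic (exists u0, open_interval a b u0)) as [[u0 Hu0] | Hempty].
- exists (g u0); intros u Hu.
  destruct (Rtotal_order u u0) as [H | [-> | H]]; [ | reflexivity | symmetry];
    now apply Hlt.
- exists 0; intros u Hu; exfalso; eauto.
Qed.

Lemma Derive_cosh (v : R) : Derive cosh v = sinh v.
Proof. apply is_derive_unique, is_derive_Reals, derivable_pt_lim_cosh. Qed.

Lemma Derive_sinh (v : R) : Derive sinh v = cosh v.
Proof. apply is_derive_unique, is_derive_Reals, derivable_pt_lim_sinh. Qed.

(** An equality of functions rather than of values, so that it rewrites under a second partial
    derivative. *)
Lemma pd1_revolution (f : R -> R) :
  pd1 (revolution_surface f) = fun u v => (cosh v, sinh v, Derive f u).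
Proof.
extensionality u; extensionality v.
unfold pd1, Derive3, revolution_surface, coord1, coord2, coord3; simpl.
rewrite !Derive_scal_l, Derive_id, !Rmult_1_l; reflexivity.
Qed.

Lemma pd2_revolution (f : R -> R) :
  pd2 (revolution_surface f) = fun u v => (u * sinh v, u * cosh v, 0).
Proof.
extensionality u; extensionality v.
unfold pd2, Derive3, revolution_surface, coord1, coord2, coord3; simpl.
rewrite !Derive_scal, Derive_const.
change (fun s : R => cosh s) with cosh; change (fun s : R => sinh s) with sinh.
rewrite Derive_cosh, Derive_sinh; reflexivity.
Qed.

Lemma pd11_revolution (f : R -> R) (u v : R) :
  pd1 (pd1 (revolution_surface f)) u v = (0, 0, Derive (Derive f) u).
Proof.
rewrite pd1_revolution.
unfold pd1, Derive3, coord1, coord2, coord3; simpl.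
rewrite !Derive_const; reflexivity.
Qed.

Lemma pd22_revolution (f : R -> R) (u v : R) :
  pd2 (pd2 (revolution_surface f)) u v = (u * cosh v, u * sinh v, 0).
Proof.
rewrite pd2_revolution.
unfold pd2, Derive3, coord1, coord2, coord3; simpl.
rewrite !Derive_scal, Derive_const.
change (fun s : R => cosh s) with cosh; change (fun s : R => sinh s) with sinh.
rewrite Derive_cosh, Derive_sinh; reflexivity.
Qed.

(** The profile curve [v = 0] is enough to obtain the differential equation for [f], and there
    [cosh] and [sinh] reduce to 1 and 0. Positivity of [u] gives [sqrt (Rabs (- u ^ 2)) = u]. *)
Lemma mean_curvature_revolution (f : R -> R) (u : R) : 0 < u ->
  mean_curvature (revolution_surface f) u 0
  = (Derive f u + u * Derive (Derive f) u) / (2 * u).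
Proof.
intros Hu.
assert (Hdet : gdet (revolution_surface f) u 0 = - u ^ 2).
{ unfold gdet, gcoef; rewrite pd1_revolution, pd2_revolution.
  unfold pi_dot, coord1, coord2; simpl; rewrite cosh_0, sinh_0; ring. }
assert (Hsqrt : sqrt (Rabs (gdet (revolution_surface f) u 0)) = u).
{ rewrite Hdet, Rabs_Ropp, Rabs_pos_eq by apply pow2_ge_0.
  apply sqrt_pow2; lra. }
(* Orthogonality of the coordinate curves cancels the [h12] term, so the mixed second derivative is
   never computed. *)
assert (Hg12 : gcoef pd1 pd2 (revolution_surface f) u 0 = 0).
{ unfold gcoef; rewrite pd1_revolution, pd2_revolution.
  unfold pi_dot, coord1, coord2; simpl; rewrite cosh_0, sinh_0; ring. }
unfold mean_curvature; rewrite Hg12, Hdet.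
unfold hcoef, gcoef; rewrite Hsqrt, pd11_revolution, pd22_revolution,
  pd1_revolution, pd2_revolution.
unfold pi_dot, det3, coord1, coord2, coord3; simpl; rewrite cosh_0, sinh_0.
field; lra.
Qed.

Theorem theorem5p2 (a b : Rbar) (f : R -> R) (H0 : R)
  (Ipos : forall u : R, open_interval a b u -> 0 < u)
  (fsmooth : smooth_on (open_interval a b) f)
  (cmc : forall u v : R, open_interval a b u ->
     mean_curvature (revolution_surface f) u v = H0) :
  exists c1 c2 : R, forall u : R, open_interval a b u ->
    f u = H0 / 2 * u ^ 2 + c1 * ln u + c2.
Proof.
destruct (is_derive_zero_constant a b (fun u => u * Derive f u - H0 * u ^ 2))
  as [c1 Hc1].
{ intros u Hu; pose proof (Ipos u Hu) as Hpos.
  (* [ex_derive_n f 2 u] is convertible to differentiability of [Derive f] at [u]. *)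
  pose proof (fsmooth 2%nat u Hu : ex_derive (Derive f) u) as Hf2.
  pose proof (cmc u 0 Hu) as HH.
  rewrite mean_curvature_revolution in HH by exact Hpos.
  auto_derive; [tauto | ].
  change (fun x : R => Derive f x) with (Derive f).
  rewrite <- HH; field; lra. }
(* The first integral [u f' - H0 u^2 = c1] gives [f' = H0 u + c1 / u], so the first constant becomes
   the coefficient of [ln]. *)
destruct (is_derive_zero_constant a b
  (fun u => f u - H0 / 2 * u ^ 2 - c1 * ln u)) as [c2 Hc2].
{ intros u Hu; pose proof (Ipos u Hu) as Hpos.
  pose proof (fsmooth 1%nat u Hu : ex_derive f u) as Hf1.
  auto_derive; [tauto | ].
  change (fun x : R => f x) with f.
  rewrite <- (Hc1 u Hu); field; lra. }
exists c1, c2; intros u Hu; rewrite <- (Hc2 u Hu); ring.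
Qed.
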